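(* Let $A$ be a Green $\mathcal D$-biset functor. 1. The maps sending $\alpha\in CA(L)$ to $\rho_\alpha\in ZA(L)$, for $L\in\mathcal D$, define a morphism of Green biset functors $\iota_A:CA\to ZA$. 2. The maps sending $t\in ZA(L)$, given by the family $(t_G)_{G\in\mathcal D}$, to $t_1\in A(L)$, for $L\in\mathcal D$, define a morphism of Green biset functors $\pi_A:ZA\to A$. The image of this morphism in the component $1$ lies in $Z(A(1))$, hence there is a morphism of rings $\pi_{A,1}:ZA(1)\to Z(A(1))$. 3. The composition $\pi_A\circ\iota_A:CA\to A$ is equal to the inclusion $CA\hookrightarrow A$. In particular $\iota_A$ is injective.
   Context: Throughout, $R$ is a commutative unital ring, all groups are finite, and $\mathcal D$ is a non-empty class of finite groups closed under subquotients (so also under isomorphism) and cartesian products. The category $R\mathcal D$ has the groups in $\mathcal D$ as objects, $\mathrm{Hom}_{R\mathcal D}(G,H)=RB(H,G)=R\otimes_{\mathbb Z}B(H,G)$, where $B(H,G)$ is the Grothendieck group of finite $(H,G)$-bisets, and composition is induced by $V\circ U=V\times_G U$; $RB(H,G)$ is identified with $RB(H\times G)$. A $\mathcal D$-biset functor is an $R$-linear functor $R\mathcal D\to R\text{-Mod}$. $\mathrm{Res}^G_K$ (resp. $\mathrm{Ind}_K^G$) is $G$ as a $(K,G)$-biset (resp. $(G,K)$-biset) for an injective homomorphism $K\to G$; $\mathrm{Inf}_Q^G$ (resp. $\mathrm{Def}^G_Q$) is $Q$ as a $(G,Q)$-biset (resp. $(Q,G)$-biset) for a surjective homomorphism $G\to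 Q$; $\mathrm{Iso}$ is the biset of a group isomorphism. Products of morphisms of $R\mathcal D$ are induced by cartesian products of bisets. $\Delta(G)\le G\times G$ is the diagonal. Canonical isomorphisms of products of groups (associativity, $1\times G\cong G\cong G\times 1$) are identifications and $\times$ between groups is often omitted. A Green $\mathcal D$-biset functor is a $\mathcal D$-biset functor $A$ with $R$-bilinear products $A(G)\times A(H)\to A(G\times H)$, $(a,b)\mapsto a\times b$, and an identity element $\varepsilon\in A(1)$, associative and unital up to canonical group isomorphisms, with $A(\varphi\times\psi)(a\times b)=A(\varphi)(a)\times A(\psi)(b)$ for morphisms $\varphi,\psi$ of $R\mathcal D$. A morphism of Green functors is a natural transformation $f$ with $f(a\times b)=f(a)\times f(b)$ preserving identity elements. $A(1)$ is a ring with product $\times$ (identifying $1\times1$ with $1$), and $Z(S)$ denotes the center of a ring $S$. The unique morphism of Green functors $\upsilon_A:RB\to A$ sends a $G$-set $X$ to $A({}_GX_1)(\varepsilon)$. The commutant is $CA(G)=\{a\in A(G)\mid a\times b=A(\mathrm{Iso}_{H\times G}^{G\times H})(b\times a)\ \forall H\in\mathcal D,\forall b\in A(H)\}$; it is a Green biset subfunctor of $A$. The category $\mathcal P_A$ has objects the groups in $\mathcal D$, $\mathrm{Hom}_{\mathcal P_A}(G,H)=A(HG)$; for $\beta\in A(HG)$, $\alpha\in A(GK)$, $\beta\circ\alpha=A(H\times\overleftarrow{G}\times K)(\beta\times\alpha)$, with $\overleftarrow{G}=\mathrm{Def}^{\Delta(G)}_1\circ\mathrm{Res}^{G\times G}_{\Delta(G)}$;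 the identity of $G$ is $A(\mathrm{Ind}_{\Delta(G)}^{G\times G}\mathrm{Inf}_1^{\Delta(G)})(\varepsilon)$. The endofunctor $\rho_L=-\times L$ of $\mathcal P_A$ sends $G$ to $GL$ and $\alpha\in A(HG)$ to $\alpha\times L=A(\mathrm{Ind}_{HGL}^{HLGL}\mathrm{Inf}_{HG}^{HGL})(\alpha)$ (embedding $(h,g,l)\mapsto(h,l,g,l)$). For $G\in\mathcal D$ and $\beta\in CA(LK)$, $G\times\beta=A(\mathrm{Ind}_{GLK}^{GLGK}\mathrm{Inf}_{LK}^{GLK})(\beta):GK\to GL$ (embedding $(g,l,k)\mapsto(g,l,g,k)$); these form a natural transformation $\rho_\beta:\rho_K\to\rho_L$. In particular for $\alpha\in CA(L)=CA(L\times1)$, $\rho_\alpha:\mathrm{Id}=\rho_1\to\rho_L$ has components $\rho_{\alpha,G}=A(\mathrm{Ind}_{LG}^{GLG}\mathrm{Inf}_L^{LG})(\alpha)$ (embedding $(l,g)\mapsto(g,l,g)$). The center $ZA(L)$, defined as the natural transformations from the identity functor of the category of $A$-modules to the shift functor $\mathrm{Id}_L$ ($M\mapsto M(-\times L)$), is identified (Yoneda) with the natural transformations $t:\mathrm{Id}_{\mathcal P_A}\to\rho_L$, i.e. with families $t_G\in A(GLG)=\mathrm{Hom}_{\mathcal P_A}(G,GL)$, $G\in\mathcal D$, such that $(\alpha\times L)\circ t_G=t_H\circ\alpha$ for all $\alpha\in A(HG)$. $ZA$ is a Green $\mathcal D$-biset functor: for $u\in RB(LK)$ and $t\in ZA(K)$,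 $ZA(u)(t)=\rho_{\upsilon_A(u)}\circ t$; for $t\in ZA(L)$, $s\in ZA(K)$, $t\times s\in ZA(LK)$ has components $(t\times s)_G=t_G\circ s_G=A(G\times L\times\overleftarrow{G}\times K\times G)(t_G\times s_G)\in A(GLKG)$; the identity element is the identity natural transformation. *)

(* Defs.v *)
From HB Require Import structures.
From mathcomp Require Import all_boot all_order all_algebra all_fingroup.
From mathcomp Require Import generic_quotient boolp.

Set Implicit Arguments.
Unset Strict Implicit.
Unset Printing Implicit Defensive.

Import GRing.Theory.
Local Open Scope quotient_scope.
Local Open Scope ring_scope.


Definition prodG (G H : finGroupType) : finGroupType := (G * H)%type.

Record biset_on (H G : finGroupType) (X : finType) := BisetOn {
  lact : H -> X -> X;
  ract : X -> G -> X;
  lact1 : forall x, lact 1%g x = x;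
  lactM : forall h k x, lact (h * k)%g x = lact h (lact k x);
  ract1 : forall x, ract x 1%g = x;
  ractM : forall x g k, ract x (g * k)%g = ract (ract x g) k;
  lractA : forall h x g, lact h (ract x g) = ract (lact h x) g
}.

Record biset (H G : finGroupType) := Biset {
  bcar :> finType;
  bstr : biset_on H G bcar
}.

Notation bl U := (lact (bstr U)).
Notation br U := (ract (bstr U)).

Definition biset_iso (H G : finGroupType) (U V : biset H G) : Prop :=
  exists f : U -> V, [/\ bijective f,
    forall h x, f (bl U h x) = bl V h (f x) &
    forall x g, f (br U x g) = br V (f x) g].

(* The universe of [biset H G] is too large for the carrier of a module, so   *)
(* formal combinations of bisets use bisets carried by some ['I_n]; every     *)
(* finite biset is isomorphic to one of them ([small_iso] below).             *)
Record sbiset (H G : finGroupType) := SBiset {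
  ssize : nat;
  sstr : biset_on H G 'I_ssize
}.
HB.instance Definition _ H G := gen_eqMixin (sbiset H G).
HB.instance Definition _ H G := gen_choiceMixin (sbiset H G).

Definition sbiset_biset H G (U : sbiset H G) : biset H G := Biset (sstr U).
Coercion sbiset_biset : sbiset >-> biset.

Section Small.
Variables (H G : finGroupType) (U : biset H G).
Let X := 'I_(#|U|).
Let l (h : H) (i : X) : X := enum_rank (bl U h (enum_val i)).
Let r (i : X) (g : G) : X := enum_rank (br U (enum_val i) g).

Fact small_subproof :
  [/\ (forall i, l 1%g i = i), (forall h k i, l (h * k)%g i = l h (l k i)),
      (forall i, r i 1%g = i), (forall i g k, r i (g * k)%g = r (r i g) k) &
      (forall h i g, l h (r i g) = r (l h i) g)].
Proof.
split=> *; rewrite /l /r ?enum_rankK; first by rewrite lact1 enum_valK.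
- by rewrite lactM.
- by rewrite ract1 enum_valK.
- by rewrite ractM.
- by rewrite lractA.
Qed.

Definition small : sbiset H G :=
  let: And5 p1 p2 p3 p4 p5 := small_subproof in SBiset (BisetOn p1 p2 p3 p4 p5).

Lemma small_iso : biset_iso U small.
Proof.
rewrite /small; case: small_subproof => p1 p2 p3 p4 p5.
exists enum_rank; split => [|h x|x g] /=.
- exact: enum_rank_bij.
- by rewrite /l enum_rankK.
- by rewrite /r enum_rankK.
Qed.
End Small.

Section DisjointUnion.
Variables (H G : finGroupType) (U V : biset H G).

Definition bunion_on : biset_on H G (U + V)%type.
Proof.
exists (fun h z => match z with inl x => inl (bl U h x)
                              | inr y => inr (bl V h y) end)
       (fun z g => match z with inl x => inl (br U x g)
                              | inr y => inr (br V y g) end).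
- by case=> x; rewrite lact1.
- by move=> h k [] x; rewrite lactM.
- by case=> x; rewrite ract1.
- by case=> x g k; rewrite ractM.
- by move=> h [] x g; rewrite lractA.
Defined.

Definition bunion : biset H G := Biset bunion_on.
End DisjointUnion.

Section CartesianProduct.
Variables (H G H' G' : finGroupType) (U : biset H G) (V : biset H' G').

Definition bprod_on : biset_on (prodG H H') (prodG G G') (U * V)%type.
Proof.
exists (fun h z => (bl U h.1 z.1, bl V h.2 z.2))
       (fun z g => (br U z.1 g.1, br V z.2 g.2)).
- by case=> x y; rewrite /= !lact1.
- by move=> h k [x y]; rewrite /= !lactM.
- by case=> x y; rewrite /= !ract1.
- by move=> [x y] g k; rewrite /= !ractM.
- by move=> h [x y] g; rewrite /= !lractA.
Defined.

Definition bprod : biset (prodG H H') (prodG G G') := Biset bprod_on.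
End CartesianProduct.

(* V x_G U is the set of orbits of G on V x U for (v, u).g = (v g, g^-1 u).   *)
Section TensorProduct.
Variables (H G K : finGroupType) (V : biset H G) (U : biset G K).

Definition torbit (p : V * U) : {set V * U} :=
  [set (br V p.1 g, bl U g^-1%g p.2) | g : G].

Definition is_torbit (O : {set V * U}) : bool :=
  O \in [set torbit p | p : V * U].

Definition tmap (a : V -> V) (b : U -> U) (O : {set V * U}) : {set V * U} :=
  [set (a p.1, b p.2) | p in O].

Lemma torbitP (p : V * U) : is_torbit (torbit p).
Proof. by apply/imsetP; exists p. Qed.

Lemma tmap_torbit (a : V -> V) (b : U -> U) p :
  (forall v g, a (br V v g) = br V (a v) g) ->
  (forall u g, b (bl U g u) = bl U g (b u)) ->
  tmap a b (torbit p) = torbit (a p.1, b p.2).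
Proof.
move=> Ha Hb; apply/setP => q; apply/imsetP/imsetP => [[x /imsetP[g _ ->] ->]|].
  by exists g; rewrite //= Ha Hb.
case=> g _ ->; exists (br V p.1 g, bl U g^-1%g p.2); last by rewrite /= Ha Hb.
by apply/imsetP; exists g.
Qed.

Lemma tmapM (a c : V -> V) (b d : U -> U) O :
  tmap a b (tmap c d O) = tmap (a \o c) (b \o d) O.
Proof. by rewrite /tmap -imset_comp; apply: eq_imset. Qed.

Lemma tmap_id a b (O : {set V * U}) : a =1 id -> b =1 id -> tmap a b O = O.
Proof.
move=> a1 b1; rewrite /tmap -[RHS]imset_id; apply: eq_imset => -[v u] /=.
by rewrite a1 b1.
Qed.

Lemma is_torbit_tmap (a : V -> V) (b : U -> U) O :
  (forall v g, a (br V v g) = br V (a v) g) ->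
  (forall u g, b (bl U g u) = bl U g (b u)) ->
  is_torbit O -> is_torbit (tmap a b O).
Proof.
move=> Ha Hb /imsetP[p _ ->].
by rewrite tmap_torbit //; apply: torbitP.
Qed.

Definition tcar : finType := {O : {set V * U} | is_torbit O}.

Definition tlact (h : H) (O : tcar) : tcar :=
  exist is_torbit _ (is_torbit_tmap (a := bl V h) (b := id) (O := sval O)
    (fun v g => lractA (bstr V) h v g) (fun _ _ => erefl) (svalP O)).

Definition tract (O : tcar) (k : K) : tcar :=
  exist is_torbit _ (is_torbit_tmap (a := id) (b := fun u => br U u k) (O := sval O)
    (fun _ _ => erefl) (fun u g => esym (lractA (bstr U) g u k)) (svalP O)).

Definition tensor_on : biset_on H K tcar.
Proof.
exists tlact tract.
- by move=> O; apply: val_inj; apply: tmap_id => // x; rewrite lact1.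
- move=> h k O; apply: val_inj; rewrite /= tmapM; apply: eq_imset => p /=.
  by rewrite lactM.
- by move=> O; apply: val_inj; apply: tmap_id => // x; rewrite ract1.
- move=> O g k; apply: val_inj; rewrite /= tmapM; apply: eq_imset => p /=.
  by rewrite ractM.
- by move=> h O g; apply: val_inj; rewrite /= !tmapM.
Defined.

Definition tensor : biset H K := Biset tensor_on.
End TensorProduct.

(* For a homomorphism f : G -> H, the set H as an (H,G)-biset, resp. as a     *)
(* (G,H)-biset.                                                               *)
Section Elementary.
Variables (G H : finGroupType) (f : {multiplicative G -> H}).

Let f1 : f 1%g = 1%g.
Proof. by apply: (mulgI (f 1%g)); rewrite -gmulfM !mulg1. Qed.

Definition push_on : biset_on H G H.
Proof.
exists (fun h x => (h * x)%g) (fun x g => (x * f g)%g).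
- exact: mul1g.
- by move=> h k x; rewrite mulgA.
- by move=> x; rewrite f1 mulg1.
- by move=> x g k; rewrite gmulfM mulgA.
- by move=> h x g; rewrite mulgA.
Defined.
Definition push : biset H G := Biset push_on.

Definition pull_on : biset_on G H H.
Proof.
exists (fun g x => (f g * x)%g) (fun x h => (x * h)%g).
- by move=> x; rewrite f1 mul1g.
- by move=> h k x; rewrite gmulfM mulgA.
- exact: mulg1.
- by move=> x g k; rewrite mulgA.
- by move=> h x g; rewrite mulgA.
Defined.
Definition pull : biset G H := Biset pull_on.
End Elementary.

HB.instance Definition _ := Finite_isGroup.Build unit
  (mul := fun _ _ => tt) (one := tt) (inv := id)
  (fun _ _ _ => erefl) (fun x => let: tt := x in erefl) (fun _ => erefl).

Definition unitG : finGroupType := unit.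

(* An (H,G)-biset as an (H x G)-set, i.e. an (H x G, 1)-biset:                *)
(* (h, g).x = h x g^-1.                                                       *)
Section AsSet.
Variables (H G : finGroupType) (U : biset H G).

Definition bset_on : biset_on (prodG H G) unitG U.
Proof.
exists (fun a x => bl U a.1 (br U x a.2^-1%g)) (fun x _ => x) => //.
- by move=> x; rewrite /= invg1 ract1 lact1.
- by move=> [h g] [k l] x; rewrite /= invMg ractM lactM -(lractA _ k).
Defined.
Definition bset : biset (prodG H G) unitG := Biset bset_on.
End AsSet.

(* RB(H,G): the R-module generated by the finite (H,G)-bisets, subject to the *)
(* relations [U] = [U'] if U and U' are isomorphic, [U + V] = [U] + [V]       *)

Section Burnside.
Variables (R : comPzRingType) (H G : finGroupType).

Definition badditive (M : lmodType R) (f : biset H G -> M) : Prop :=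
  (forall U V, biset_iso U V -> f U = f V) /\
  (forall U V, f (bunion U V) = f U + f V).

Definition beval (M : lmodType R) (f : biset H G -> M)
    (l : seq (R * sbiset H G)) : M :=
  \sum_(x <- l) x.1 *: f x.2.

(* Two formal combinations are identified if they agree in every R-module in  *)
(* which the relations hold.                                                  *)
Definition brel (l l' : seq (R * sbiset H G)) : bool :=
  `[< forall (M : lmodType R) (f : biset H G -> M),
        badditive f -> beval f l = beval f l' >].

Fact brel_equiv : equiv_class_of brel.
Proof.
split=> [l | l l' | l1 l l2].
- exact/asboolP.
- by apply/asboolP/asboolP => e M f Mf; rewrite e.
- move=> /asboolP e1 /asboolP e2; apply/asboolP => M f Mf.
  by rewrite e1 // e2.
Qed.

Canonical brel_canonical := EquivRelPack brel_equiv.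

Definition RB := {eq_quot brel}.
HB.instance Definition _ := EqQuotient.on RB.
HB.instance Definition _ := Choice.on RB.

(* The R-linear extension of f, when f is [badditive]: see [rb_lift_linear]   *)
(* and [rb_lift_class].                                                       *)
Definition rb_lift (M : lmodType R) (f : biset H G -> M) (u : RB) : M :=
  beval f (repr u).

Definition rb_class (U : biset H G) : RB := \pi_RB [:: (1, small U)].

Lemma rb_lift_pi (M : lmodType R) (f : biset H G -> M) l :
  badditive f -> rb_lift f (\pi_RB l) = beval f l.
Proof.
move=> Mf; have /eqquotP/asboolP : repr (\pi_RB l) = l %[mod RB] by rewrite reprK.
exact.
Qed.

Lemma rb_eqP (u v : RB) :
  (forall (M : lmodType R) (f : biset H G -> M),
     badditive f -> rb_lift f u = rb_lift f v) <-> u = v.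
Proof.
split=> [e | -> //]; rewrite -[u]reprK -[v]reprK; apply/eqquotP/asboolP => M f.
exact: e.
Qed.

Let scalel a (l : seq (R * sbiset H G)) := [seq (a * x.1, x.2) | x <- l].

Definition rb_add (u v : RB) : RB := \pi_RB (repr u ++ repr v).
Definition rb_scale (a : R) (u : RB) : RB := \pi_RB (scalel a (repr u)).
Definition rb_zero : RB := \pi_RB [::].
Definition rb_opp (u : RB) : RB := rb_scale (-1) u.

Fact rb_liftD (M : lmodType R) (f : biset H G -> M) u v :
  badditive f -> rb_lift f (rb_add u v) = rb_lift f u + rb_lift f v.
Proof. by move=> Mf; rewrite rb_lift_pi // /beval big_cat. Qed.

Fact rb_liftZ (M : lmodType R) (f : biset H G -> M) a u :
  badditive f -> rb_lift f (rb_scale a u) = a *: rb_lift f u.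
Proof.
move=> Mf; rewrite rb_lift_pi // /beval big_map scaler_sumr.
by apply: eq_bigr => x _; rewrite scalerA.
Qed.

Fact rb_lift0 (M : lmodType R) (f : biset H G -> M) :
  badditive f -> rb_lift f rb_zero = 0.
Proof. by move=> Mf; rewrite rb_lift_pi // /beval big_nil. Qed.

Fact rb_addA : associative rb_add.
Proof. by move=> u v w; apply/rb_eqP => M f Mf; rewrite !rb_liftD // addrA. Qed.
Fact rb_addC : commutative rb_add.
Proof. by move=> u v; apply/rb_eqP => M f Mf; rewrite !rb_liftD // addrC. Qed.
Fact rb_add0 : left_id rb_zero rb_add.
Proof.
by move=> u; apply/rb_eqP => M f Mf; rewrite rb_liftD // rb_lift0 // add0r.
Qed.
Fact rb_addN : left_inverse rb_zero rb_opp rb_add.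
Proof.
move=> u; apply/rb_eqP => M f Mf.
by rewrite rb_liftD // rb_lift0 // rb_liftZ // scaleN1r addNr.
Qed.
HB.instance Definition _ :=
  GRing.isZmodule.Build RB rb_addA rb_addC rb_add0 rb_addN.

Fact rb_scaleA a b u : rb_scale a (rb_scale b u) = rb_scale (a * b) u.
Proof. by apply/rb_eqP => M f Mf; rewrite !rb_liftZ // scalerA. Qed.
Fact rb_scale1 : left_id 1 rb_scale.
Proof. by move=> u; apply/rb_eqP => M f Mf; rewrite rb_liftZ // scale1r. Qed.
Fact rb_scaleDr : right_distributive rb_scale +%R.
Proof.
move=> a u v; apply/rb_eqP => M f Mf.
by rewrite !(rb_liftZ, rb_liftD) // scalerDr.
Qed.
Fact rb_scaleDl u : {morph rb_scale^~ u : a b / a + b}.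
Proof.
move=> a b; apply/rb_eqP => M f Mf.
by rewrite !(rb_liftZ, rb_liftD) // scalerDl.
Qed.
HB.instance Definition _ :=
  GRing.Zmodule_isLmodule.Build R RB rb_scaleA rb_scale1 rb_scaleDr rb_scaleDl.

Lemma rb_lift_linear (M : lmodType R) (f : biset H G -> M) :
  badditive f -> linear (rb_lift f).
Proof.
by move=> Mf a u v; rewrite (rb_liftD (rb_scale a u)) // (rb_liftZ a).
Qed.

Lemma rb_lift_class (M : lmodType R) (f : biset H G -> M) U :
  badditive f -> rb_lift f (rb_class U) = f U.
Proof.
move=> Mf; rewrite rb_lift_pi // /beval big_seq1 scale1r; apply: esym.
exact/Mf.1/small_iso.
Qed.

Lemma rb_class_badditive : badditive rb_class.
Proof.
split=> U V.
  by move=> iUV; apply/rb_eqP => M f Mf; rewrite !rb_lift_class //; apply: Mf.1.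
apply/rb_eqP => M f Mf; rewrite rb_lift_class // (rb_liftD (rb_class U)) //.
by rewrite !rb_lift_class //; apply: Mf.2.
Qed.

End Burnside.

Arguments rb_class {R H G} U.
Notation "[biset U ]" := (rb_class U) (at level 0, U at level 99, format "[biset  U ]").

Section Operations.
Variable R : comPzRingType.

Definition rb_comp (H G K : finGroupType) (v : RB R H G) (u : RB R G K) :
    RB R H K :=
  rb_lift (fun V => rb_lift (fun U => [biset tensor V U]) u) v.

Definition rb_prod (H G H' G' : finGroupType) (v : RB R H G) (u : RB R H' G') :
    RB R (prodG H H') (prodG G G') :=
  rb_lift (fun V => rb_lift (fun U => [biset bprod V U]) u) v.

(* The identification of RB(H,G) with RB(H x G).                              *)
Definition rb_set (H G : finGroupType) (u : RB R H G) :
    RB R (prodG H G) unitG :=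
  rb_lift (fun U => [biset bset U]) u.

Definition rb_id (G : finGroupType) : RB R G G :=
  [biset push (idfun : {multiplicative G -> G})].

(* The first three are meant for f injective, surjective and bijective        *)
(* respectively, the last two for f injective and surjective respectively.    *)
Definition Ind (G H : finGroupType) (f : {multiplicative G -> H}) : RB R H G :=
  [biset push f].
Definition Def (G H : finGroupType) (f : {multiplicative G -> H}) : RB R H G :=
  [biset push f].
Definition Iso (G H : finGroupType) (f : {multiplicative G -> H}) : RB R H G :=
  [biset push f].
Definition Res (G H : finGroupType) (f : {multiplicative G -> H}) : RB R G H :=
  [biset pull f].
Definition Inf (G H : finGroupType) (f : {multiplicative G -> H}) : RB R G H :=
  [biset pull f].

End Operations.

Section OperationsE.
Variable R : comPzRingType.
Implicit Types H G K : finGroupType.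

Section TensorMap.
Variables (H G K : finGroupType) (V V' : biset H G) (U U' : biset G K).
Variables (a : V -> V') (b : U -> U').
Hypothesis ar : forall v g, a (br V v g) = br V' (a v) g.
Hypothesis bl_ : forall g u, b (bl U g u) = bl U' g (b u).
Let ab (p : V * U) := (a p.1, b p.2).

Lemma imset_torbit p : ab @: torbit p = torbit (ab p).
Proof.
apply/setP => q; apply/imsetP/imsetP => [[x /imsetP[g _ ->] ->]|].
  by exists g; rewrite //= /ab ar bl_.
case=> g _ ->; exists (br V p.1 g, bl U g^-1%g p.2); last by rewrite /= /ab ar bl_.
by apply/imsetP; exists g.
Qed.

Fact tensor_map_subproof (O : tensor V U) : @is_torbit _ _ _ V' U' (ab @: sval O).
Proof. by case: O => O /= /imsetP[p _ ->]; rewrite imset_torbit torbitP. Qed.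

Definition tensor_map (O : tensor V U) : tensor V' U' :=
  exist (@is_torbit _ _ _ V' U') _ (tensor_map_subproof O).

Lemma tensor_mapl : (forall h v, a (bl V h v) = bl V' h (a v)) ->
  forall h O, tensor_map (bl (tensor V U) h O) = bl (tensor V' U') h (tensor_map O).
Proof.
move=> al h O; apply: val_inj.
change (ab @: tmap (bl V h) id (sval O) = tmap (bl V' h) id (ab @: sval O)).
rewrite /tmap -!imset_comp.
by apply: eq_imset => p /=; rewrite /ab /= al.
Qed.

Lemma tensor_mapr : (forall u k, b (br U u k) = br U' (b u) k) ->
  forall O k, tensor_map (br (tensor V U) O k) = br (tensor V' U') (tensor_map O) k.
Proof.
move=> br_ O k; apply: val_inj.
change (ab @: tmap id (fun u => br U u k) (sval O) =
        tmap id (fun u => br U' u k) (ab @: sval O)).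
rewrite /tmap -!imset_comp.
by apply: eq_imset => p /=; rewrite /ab /= br_.
Qed.

Lemma tensor_map_inj : injective a -> injective b -> injective tensor_map.
Proof.
move=> ai bi O O' /(congr1 val) /= /imset_inj e; apply/val_inj/e.
by move=> [x y] [z t] [/ai-> /bi->].
Qed.

Lemma torbit_refl (p : V * U) : p \in torbit p.
Proof. by apply/imsetP; exists 1%g; rewrite // ract1 invg1 lact1 -surjective_pairing. Qed.

End TensorMap.

Definition tclass H G K (V : biset H G) (U : biset G K) p : tensor V U :=
  exist (@is_torbit _ _ _ V U) _ (torbitP p).

Lemma torbit_eq H G K (V : biset H G) (U : biset G K) (O O' : tensor V U) p :
  p \in sval O -> p \in sval O' -> O = O'.
Proof.
have sub (x y : V * U) : x \in torbit y -> torbit x = torbit y.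
  case/imsetP => g _ ->; apply/setP => z; apply/imsetP/imsetP => -[k _ ->] /=.
    by exists (g * k)%g; rewrite // ractM -lactM invMg.
  by exists (g^-1 * k)%g; rewrite // -ractM -lactM invMg invgK mulgA mulgV mul1g
    -mulgA mulgV mulg1.
case: O O' => O /= OP [O' /= O'P] pO pO'; apply: val_inj => /=.
case/imsetP: OP pO => x _ -> /sub <-.
by case/imsetP: O'P pO' => y _ -> /sub <-.
Qed.

Lemma tensor_class H G K (V : biset H G) (U : biset G K) (O : tensor V U) :
  exists p, sval O = torbit p.
Proof. by case: O => O /= /imsetP[p _ ->]; exists p. Qed.

Lemma inj_surj_bij (S T : finType) (f : S -> T) :
  injective f -> (forall y, exists x, f x = y) -> bijective f.
Proof.
move=> fi fs; apply: inj_card_bij => //.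
have [g gK] := choice fs.
exact: leq_card (can_inj gK).
Qed.

Lemma tensor_iso H G K (V V' : biset H G) (U U' : biset G K) :
  biset_iso V V' -> biset_iso U U' -> biset_iso (tensor V U) (tensor V' U').
Proof.
move=> [a [abij al ar]] [b [bbij bl_ br_]].
exists (tensor_map ar bl_); split; last 2 first.
- exact: tensor_mapl.
- exact: tensor_mapr.
have ai := bij_inj abij; have bi := bij_inj bbij.
apply: inj_surj_bij; first exact: tensor_map_inj.
move=> O; have [[v' u'] eO] := tensor_class O.
have [[a' aK a'K] [b' bK b'K]] := (abij, bbij).
exists (tclass (a' v', b' u')); apply: val_inj.
by rewrite /= imset_torbit //= a'K b'K eO.
Qed.

Lemma biset_iso_refl H G (U : biset H G) : biset_iso U U.
Proof. by exists id; split=> //; exists id. Qed.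

Lemma biset_iso_sym H G (U V : biset H G) : biset_iso U V -> biset_iso V U.
Proof.
move=> [f [[g fK gK] fl fr]]; exists g; split=> [|h x|x k]; first by exists f.
  by apply: (can_inj fK); rewrite fl !gK.
by apply: (can_inj fK); rewrite fr !gK.
Qed.

Lemma tensor_unionl H G K (V V' : biset H G) (U : biset G K) :
  biset_iso (tensor (bunion V V') U) (bunion (tensor V U) (tensor V' U)).
Proof.
apply: biset_iso_sym.
pose L : V -> bunion V V' := inl; pose L' : V' -> bunion V V' := inr.
pose F := @tensor_map _ _ _ V (bunion V V') U U L id (fun _ _ => erefl) (fun _ _ => erefl).
pose F' := @tensor_map _ _ _ V' (bunion V V') U U L' id (fun _ _ => erefl) (fun _ _ => erefl).
exists (fun z => match z with inl x => F x | inr x => F' x end).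
split; last 2 first.
- by move=> h [] O; apply: tensor_mapl.
- by move=> [] O k; apply: tensor_mapr.
apply: inj_surj_bij => [|O].
  have Fi : injective F by apply: tensor_map_inj => // x y [].
  have Fi' : injective F' by apply: tensor_map_inj => // x y [].
  have FF' O O' : F O <> F' O'.
    move=> e; have [p eO] := tensor_class O.
    have: (L p.1, p.2) \in sval (F O).
      by apply/imsetP; exists p => //; rewrite eO torbit_refl.
    by rewrite e => /imsetP[].
  move=> [] O [] O' e; try by [rewrite (Fi _ _ e) | rewrite (Fi' _ _ e)].
    by case: (FF' _ _ e).
  by case: (FF' _ _ (esym e)).
have [[[v|v] u] eO] := tensor_class O.
  exists (inl (tclass (v, u))); apply: val_inj.
  by apply: (etrans _ (esym eO)); apply: (@imset_torbit _ _ _ _ _ _ _ L id (fun _ _ => erefl) (fun _ _ => erefl)).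
exists (inr (tclass (v, u))); apply: val_inj.
by apply: (etrans _ (esym eO)); apply: (@imset_torbit _ _ _ _ _ _ _ L' id (fun _ _ => erefl) (fun _ _ => erefl)).
Qed.

Lemma tensor_unionr H G K (V : biset H G) (U U' : biset G K) :
  biset_iso (tensor V (bunion U U')) (bunion (tensor V U) (tensor V U')).
Proof.
apply: biset_iso_sym.
pose L : U -> bunion U U' := inl; pose L' : U' -> bunion U U' := inr.
pose F := @tensor_map _ _ _ V V U (bunion U U') id L (fun _ _ => erefl) (fun _ _ => erefl).
pose F' := @tensor_map _ _ _ V V U' (bunion U U') id L' (fun _ _ => erefl) (fun _ _ => erefl).
exists (fun z => match z with inl x => F x | inr x => F' x end).
split; last 2 first.
- by move=> h [] O; apply: tensor_mapl.
- by move=> [] O k; apply: tensor_mapr.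
apply: inj_surj_bij => [|O].
  have Fi : injective F by apply: tensor_map_inj => // x y [].
  have Fi' : injective F' by apply: tensor_map_inj => // x y [].
  have FF' O O' : F O <> F' O'.
    move=> e; have [p eO] := tensor_class O.
    have: (p.1, L p.2) \in sval (F O).
      by apply/imsetP; exists p => //; rewrite eO torbit_refl.
    by rewrite e => /imsetP[].
  move=> [] O [] O' e; try by [rewrite (Fi _ _ e) | rewrite (Fi' _ _ e)].
    by case: (FF' _ _ e).
  by case: (FF' _ _ (esym e)).
have [[v [u|u]] eO] := tensor_class O.
  exists (inl (tclass (v, u))); apply: val_inj.
  by apply: (etrans _ (esym eO)); apply: (@imset_torbit _ _ _ _ _ _ _ id L (fun _ _ => erefl) (fun _ _ => erefl)).
exists (inr (tclass (v, u))); apply: val_inj.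
by apply: (etrans _ (esym eO)); apply: (@imset_torbit _ _ _ _ _ _ _ id L' (fun _ _ => erefl) (fun _ _ => erefl)).
Qed.

Lemma bprod_iso H G H' G' (V W : biset H G) (U T : biset H' G') :
  biset_iso V W -> biset_iso U T -> biset_iso (bprod V U) (bprod W T).
Proof.
move=> [a [[a' aK a'K] al ar]] [b [[b' bK b'K] bl_ br_]].
exists (fun p => (a p.1, b p.2)); split=> [|h p|p g] /=.
- by exists (fun p => (a' p.1, b' p.2)) => -[x y] /=; rewrite ?aK ?bK ?a'K ?b'K.
- by rewrite al bl_.
- by rewrite ar br_.
Qed.

Lemma bprod_unionl H G H' G' (V V' : biset H G) (U : biset H' G') :
  biset_iso (bprod (bunion V V') U) (bunion (bprod V U) (bprod V' U)).
Proof.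
exists (fun p : bprod (bunion V V') U =>
          match p.1 with inl v => inl (v, p.2) | inr v => inr (v, p.2) end
          : bunion (bprod V U) (bprod V' U)); split.
- exists (fun z => match z with inl p => (inl p.1, p.2)
                              | inr p => (inr p.1, p.2) end).
    by move=> [[] ? ?].
  by move=> [[? ?]|[? ?]].
- by move=> h [[] ? ?].
- by move=> [[] ? ?] g.
Qed.

Lemma bprod_unionr H G H' G' (V : biset H G) (U U' : biset H' G') :
  biset_iso (bprod V (bunion U U')) (bunion (bprod V U) (bprod V U')).
Proof.
exists (fun p : bprod V (bunion U U') =>
          match p.2 with inl v => inl (p.1, v) | inr v => inr (p.1, v) end
          : bunion (bprod V U) (bprod V U')); split.
- exists (fun z => match z with inl p => (p.1, inl p.2)
                              | inr p => (p.1, inr p.2) end).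
    by move=> [? []].
  by move=> [[? ?]|[? ?]].
- by move=> h [? []].
- by move=> [? []] g.
Qed.

Lemma bset_iso H G (U V : biset H G) :
  biset_iso U V -> biset_iso (bset U) (bset V).
Proof.
by move=> [f [fbij fl fr]]; exists f; split=> // h x; rewrite /= fl fr.
Qed.

Lemma bset_union H G (U V : biset H G) :
  biset_iso (bset (bunion U V)) (bunion (bset U) (bset V)).
Proof.
exists (id : bset (bunion U V) -> bunion (bset U) (bset V)).
split; [by exists id | by move=> h [] x | by move=> [] x g].
Qed.

Local Lemma rb_class_iso H G (U V : biset H G) :
  biset_iso U V -> [biset U] = [biset V] :> RB R H G.
Proof. exact: (rb_class_badditive R H G).1. Qed.

Local Lemma rb_class_union H G (U V : biset H G) :
  [biset bunion U V] = [biset U] + [biset V] :> RB R H G.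
Proof. exact: (rb_class_badditive R H G).2. Qed.

Local Lemma rb_lift2 H G H' G' (M : lmodType R) (f : biset H G -> biset H' G' -> M)
    (u : RB R H' G') :
  (forall U, badditive (f^~ U)) -> badditive (fun V => rb_lift (f V) u).
Proof.
move=> fM; split=> [V V' i | V V']; rewrite /rb_lift /beval.
  by apply: eq_bigr => x _; rewrite ((fM _).1 _ _ i).
by rewrite -big_split; apply: eq_bigr => x _; rewrite /= (fM _).2 scalerDr.
Qed.

Let tensorl H G K (U : biset G K) :
  badditive (fun V : biset H G => [biset tensor V U] : RB R H K).
Proof.
split=> V V' => [i|]; last by rewrite -rb_class_union; apply/rb_class_iso/tensor_unionl.
by apply/rb_class_iso/tensor_iso => //; apply: biset_iso_refl.
Qed.

Let tensorr H G K (V : biset H G) :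
  badditive (fun U : biset G K => [biset tensor V U] : RB R H K).
Proof.
split=> U U' => [i|]; last by rewrite -rb_class_union; apply/rb_class_iso/tensor_unionr.
by apply/rb_class_iso/tensor_iso => //; apply: biset_iso_refl.
Qed.

Lemma rb_comp_class H G K (V : biset H G) (U : biset G K) :
  rb_comp [biset V] [biset U] = [biset tensor V U] :> RB R H K.
Proof.
rewrite /rb_comp rb_lift_class; first by rewrite rb_lift_class //; apply: tensorr.
by apply: rb_lift2 => W; apply: tensorl.
Qed.

Lemma rb_comp_linearl H G K (u : RB R G K) :
  linear (fun v : RB R H G => rb_comp v u).
Proof. by apply/rb_lift_linear/rb_lift2 => W; apply: tensorl. Qed.

Lemma rb_comp_linearr H G K (v : RB R H G) :
  linear (fun u : RB R G K => rb_comp v u).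
Proof.
move=> a u w; rewrite /rb_comp {1}/rb_lift /beval.
under eq_bigr => x _ do rewrite (rb_lift_linear (@tensorr H G K x.2)) scalerDr.
rewrite big_split scaler_sumr; congr (_ + _).
by apply: eq_bigr => x _; rewrite !scalerA mulrC.
Qed.

Let prodl H G H' G' (U : biset H' G') :
  badditive (fun V : biset H G => [biset bprod V U] : RB R _ _).
Proof.
split=> V V' => [i|]; last by rewrite -rb_class_union; apply/rb_class_iso/bprod_unionl.
by apply/rb_class_iso/bprod_iso => //; apply: biset_iso_refl.
Qed.

Let prodr H G H' G' (V : biset H G) :
  badditive (fun U : biset H' G' => [biset bprod V U] : RB R _ _).
Proof.
split=> U U' => [i|]; last by rewrite -rb_class_union; apply/rb_class_iso/bprod_unionr.
by apply/rb_class_iso/bprod_iso => //; apply: biset_iso_refl.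
Qed.

Lemma rb_prod_class H G H' G' (V : biset H G) (U : biset H' G') :
  rb_prod [biset V] [biset U] = [biset bprod V U] :> RB R _ _.
Proof.
rewrite /rb_prod rb_lift_class; first by rewrite rb_lift_class //; apply: prodr.
by apply: rb_lift2 => W; apply: prodl.
Qed.

Lemma rb_prod_linearl H G H' G' (u : RB R H' G') :
  linear (fun v : RB R H G => rb_prod v u).
Proof. by apply/rb_lift_linear/rb_lift2 => W; apply: prodl. Qed.

Lemma rb_prod_linearr H G H' G' (v : RB R H G) :
  linear (fun u : RB R H' G' => rb_prod v u).
Proof.
move=> a u w; rewrite /rb_prod {1}/rb_lift /beval.
under eq_bigr => x _ do rewrite (rb_lift_linear (@prodr H G H' G' x.2)) scalerDr.
rewrite big_split scaler_sumr; congr (_ + _).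
by apply: eq_bigr => x _; rewrite !scalerA mulrC.
Qed.

Let bset_badditive H G :
  badditive (fun U : biset H G => [biset bset U] : RB R _ _).
Proof.
split=> U U' => [i|]; first exact/rb_class_iso/bset_iso.
by rewrite -rb_class_union; apply/rb_class_iso/bset_union.
Qed.

Lemma rb_set_class H G (U : biset H G) :
  rb_set [biset U] = [biset bset U] :> RB R _ _.
Proof. exact/rb_lift_class/bset_badditive. Qed.

Lemma rb_set_linear H G : linear (@rb_set R H G).
Proof. exact/rb_lift_linear/bset_badditive. Qed.

End OperationsE.


Record group_class := GroupClass {
  gc_mem :> finGroupType -> Prop;
  gc_nonempty : exists G : finGroupType, gc_mem G;
  gc_subquo : forall (G Q : finGroupType) (K N : {group G}),
    gc_mem G -> (N <| K)%g -> ([set: Q] \isog K / N)%g -> gc_mem Q;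
  gc_prod : forall G H : finGroupType,
    gc_mem G -> gc_mem H -> gc_mem (prodG G H)
}.

Record dgroup (D : group_class) := DGroup {
  dsort :> finGroupType;
  dsortP : D dsort
}.

Definition dprod (D : group_class) (G H : dgroup D) : dgroup D :=
  DGroup (gc_prod (dsortP G) (dsortP H)).

Fact gc_unit (D : group_class) : D unitG.
Proof.
have [G DG] := gc_nonempty D.
apply: (gc_subquo (K := 1%G) (N := 1%G) DG (normal_refl _)).
rewrite trivg_quotient (_ : [set: unitG] = 1%g) ?trivial_isog //.
by apply/setP => -[]; rewrite !inE.
Qed.
Definition dunit (D : group_class) : dgroup D := DGroup (gc_unit D).

Declare Scope dgroup_scope.
Delimit Scope dgroup_scope with D.
Bind Scope dgroup_scope with dgroup.
Notation "G * H" := (dprod G H) : dgroup_scope.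
Notation "1" := (dunit _) : dgroup_scope.

Section GroupHom.
Variables (G H : finGroupType) (f : G -> H) (fM : {morph f : x y / (x * y)%g}).
Definition mkhom : {multiplicative G -> H} :=
  HB.pack_for {multiplicative G -> H} f (isMultiplicative.Build G H f fM).
End GroupHom.

(* The homomorphism G -> H given by a function f made of projections and      *)
(* pairings, for which the morphism property holds by computation.            *)
Arguments mkhom {G H} & f fM.
Notation hom f := (mkhom f (fun _ _ => erefl)).

Record green_functor (R : comPzRingType) (D : group_class) := GreenFunctor {
  gmod :> dgroup D -> lmodType R;
  gact : forall G H : dgroup D, RB R H G -> gmod G -> gmod H;
  gact_linear : forall (G H : dgroup D) (u : RB R H G), linear (gact u);
  gact_linearl : forall (G H : dgroup D) (a : gmod G),
    linear (fun u : RB R H G => gact u a);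
  gact_id : forall (G : dgroup D) (a : gmod G), gact (rb_id R G) a = a;
  gact_comp : forall (G H K : dgroup D) (v : RB R K H) (u : RB R H G) a,
    gact (rb_comp v u) a = gact v (gact u a);
  gmul : forall G H : dgroup D, gmod G -> gmod H -> gmod (G * H)%D;
  gone : gmod 1%D;
  gmul_linearl : forall (G H : dgroup D) (b : gmod H),
    linear (fun a : gmod G => gmul a b);
  gmul_linearr : forall (G H : dgroup D) (a : gmod G),
    linear (fun b : gmod H => gmul a b);
  gmulA : forall (G H K : dgroup D) (a : gmod G) (b : gmod H) (c : gmod K),
    gact (G := (G * H * K)%D) (H := (G * (H * K))%D)
      (Iso R (hom (fun x => (x.1.1, (x.1.2, x.2))))) (gmul (gmul a b) c) =
    gmul a (gmul b c);
  gmul1l : forall (G : dgroup D) (a : gmod G),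
    gact (G := (1 * G)%D) (H := G) (Iso R (hom (fun x => x.2))) (gmul gone a) = a;
  gmul1r : forall (G : dgroup D) (a : gmod G),
    gact (G := (G * 1)%D) (H := G) (Iso R (hom (fun x => x.1))) (gmul a gone) = a;
  gact_mul : forall (G H G' H' : dgroup D) (u : RB R H G) (v : RB R H' G')
      (a : gmod G) (b : gmod G'),
    gact (G := (G * G')%D) (H := (H * H')%D) (rb_prod u v) (gmul a b) =
    gmul (gact u a) (gact v b)
}.

(* The operations underlying a Green biset functor. The value at G is the     *)
(* R-module of the elements of [gd_car G] which satisfy [gd_mem]; it need not *)
(* be an [lmodType], as families indexed by all the groups in D are too large *)
(* to be one. The elements outside [gd_mem] are irrelevant.                   *)
Record green_data (R : comPzRingType) (D : group_class) := GreenData {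
  gd_car :> dgroup D -> Type;
  gd_mem : forall G : dgroup D, gd_car G -> Prop;
  gd_add : forall G : dgroup D, gd_car G -> gd_car G -> gd_car G;
  gd_scale : forall G : dgroup D, R -> gd_car G -> gd_car G;
  gd_act : forall G H : dgroup D, RB R H G -> gd_car G -> gd_car H;
  gd_mul : forall G H : dgroup D, gd_car G -> gd_car H -> gd_car (G * H)%D;
  gd_one : gd_car 1%D
}.

Definition gdata (R : comPzRingType) (D : group_class)
    (A : green_functor R D) : green_data R D :=
  {| gd_car := fun G => A G; gd_mem := fun _ _ => True;
     gd_add := fun _ a b => a + b; gd_scale := fun _ r a => r *: a;
     gd_act := @gact R D A; gd_mul := @gmul R D A; gd_one := gone A |}.

Record green_morphism (R : comPzRingType) (D : group_class)
    (X Y : green_data R D) (f : forall G : dgroup D, X G -> Y G) : Prop :=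
  GreenMorphism {
  gm_mem : forall (G : dgroup D) (a : X G), gd_mem a -> gd_mem (f G a);
  gm_add : forall (G : dgroup D) (a b : X G), gd_mem a -> gd_mem b ->
    f G (gd_add a b) = gd_add (f G a) (f G b);
  gm_scale : forall (G : dgroup D) (r : R) (a : X G), gd_mem a ->
    f G (gd_scale r a) = gd_scale r (f G a);
  gm_act : forall (G H : dgroup D) (u : RB R H G) (a : X G), gd_mem a ->
    f H (gd_act u a) = gd_act u (f G a);
  gm_mul : forall (G H : dgroup D) (a : X G) (b : X H), gd_mem a -> gd_mem b ->
    f (G * H)%D (gd_mul a b) = gd_mul (f G a) (f H b);
  gm_one : f 1%D (gd_one X) = gd_one Y
}.

(* The product of the ring X(1), identifying 1 x 1 with 1.                    *)
Definition ring1_mul (R : comPzRingType) (D : group_class) (X : green_data R D)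
    (a b : X 1%D) : X 1%D :=
  gd_act (G := (1 * 1)%D) (H := 1%D) (Iso R (hom (fun x => x.1))) (gd_mul a b).

Definition ring1_center (R : comPzRingType) (D : group_class)
    (X : green_data R D) (a : X 1%D) : Prop :=
  gd_mem a /\ forall b : X 1%D, gd_mem b -> ring1_mul a b = ring1_mul b a.

Record ring1_morphism_to_center (R : comPzRingType) (D : group_class)
    (X Y : green_data R D) (f : X 1%D -> Y 1%D) : Prop := Ring1Morphism {
  r1_center : forall a, gd_mem a -> ring1_center (f a);
  r1_add : forall a b, gd_mem a -> gd_mem b ->
    f (gd_add a b) = gd_add (f a) (f b);
  r1_mul : forall a b, gd_mem a -> gd_mem b ->
    f (ring1_mul a b) = ring1_mul (f a) (f b);
  r1_one : f (gd_one X) = gd_one Y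
}.

Section Green.
Variables (R : comPzRingType) (D : group_class) (A : green_functor R D).
Implicit Types G H K L : dgroup D.

(* A(Iso(f)), used to make the canonical isomorphisms explicit.               *)
Definition gtr G H (f : {multiplicative G -> H}) : A G -> A H := gact (Iso R f).

Definition in_commutant G (a : A G) : Prop :=
  forall H (b : A H),
    gmul a b = gtr (G := (H * G)%D) (H := (G * H)%D)
                   (hom (fun x => (x.2, x.1))) (gmul b a).

Definition CA : green_data R D :=
  {| gd_car := fun G => A G; gd_mem := in_commutant;
     gd_add := fun _ a b => a + b; gd_scale := fun _ r a => r *: a;
     gd_act := @gact R D A; gd_mul := @gmul R D A; gd_one := gone A |}.

(* The morphism from G x G to 1, Def^Delta(G)_1 o Res^(G x G)_Delta(G), with  *)
(* Delta(G) identified to G.                                                  *)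
Definition contract G : RB R (dunit D) (G * G)%D :=
  rb_comp (Def R (hom (fun=> 1%g) : {multiplicative G -> dunit D}))
          (Res R (hom (fun x => (x, x)) : {multiplicative G -> (G * G)%D})).

Definition gcontract H G K : A (H * (G * G * K))%D -> A (H * (1 * K))%D :=
  gact (G := (H * (G * G * K))%D) (H := (H * (1 * K))%D)
    (rb_prod (rb_id R H) (rb_prod (contract G) (rb_id R K))).

Definition pcomp H G K (b : A (H * G)%D) (a : A (G * K)%D) : A (H * K)%D :=
  gtr (G := (H * (1 * K))%D) (H := (H * K)%D) (hom (fun x => (x.1, x.2.2)))
    (gcontract
      (gtr (G := (H * G * (G * K))%D) (H := (H * (G * G * K))%D)
           (hom (fun x => (x.1.1, ((x.1.2, x.2.1), x.2.2))))
        (gmul b a))).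

Definition pid G : A (G * G)%D :=
  gact (rb_comp
      (Ind R (hom (fun x => (x, x)) : {multiplicative G -> (G * G)%D}))
      (Inf R (hom (fun=> 1%g) : {multiplicative G -> dunit D})))
    (gone A).

(* alpha x L : GL -> HL                                                       *)
Definition pshift L H G (a : A (H * G)%D) : A ((H * L) * (G * L))%D :=
  gact (rb_comp
    (Ind R (hom (fun x => ((x.1.1, x.2), (x.1.2, x.2)))
       : {multiplicative (H * G * L)%D -> ((H * L) * (G * L))%D}))
    (Inf R (hom (fun x => x.1) : {multiplicative (H * G * L)%D -> (H * G)%D})))
  a.

(* rho_(b,G) = G x b : GK -> GL, for b in CA(LK)                              *)
Definition rho2 L K (b : A (L * K)%D) G : A ((G * L) * (G * K))%D :=
  gact (rb_comp
    (Ind R (hom (fun x => ((x.1, x.2.1), (x.1, x.2.2)))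
       : {multiplicative (G * (L * K))%D -> ((G * L) * (G * K))%D}))
    (Inf R (hom (fun x => x.2)
       : {multiplicative (G * (L * K))%D -> (L * K)%D})))
  b.

(* rho_(a,G) : G -> GL, for a in CA(L)                                        *)
Definition rho L (a : A L) G : A ((G * L) * G)%D :=
  gact (rb_comp
    (Ind R (hom (fun x => ((x.2, x.1), x.2))
       : {multiplicative (L * G)%D -> ((G * L) * G)%D}))
    (Inf R (hom (fun x => x.1) : {multiplicative (L * G)%D -> L})))
  a.

(* upsilon_A(u) for u in RB(LK) = RB(L,K)                                     *)
Definition upsilon L K (u : RB R L K) : A (L * K)%D :=
  gact (G := 1%D) (H := (L * K)%D) (rb_set u) (gone A).

Definition Zfam L : Type := forall G, A ((G * L) * G)%D.

Definition in_center L (t : Zfam L) : Prop :=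
  forall G H (a : A (H * G)%D),
    pcomp (pshift L a) (t G) = pcomp (t H) a.

Definition Zact K L (u : RB R L K) (t : Zfam K) : Zfam L :=
  fun G => pcomp (rho2 (upsilon u) G) (t G).

Definition Zmul L K (t : Zfam L) (s : Zfam K) : Zfam (L * K)%D :=
  fun G =>
    gtr (G := ((G * L) * (1 * (K * G)))%D) (H := ((G * (L * K)) * G)%D)
        (hom (fun x => ((x.1.1, (x.1.2, x.2.2.1)), x.2.2.2)))
      (gcontract
        (gtr (G := (((G * L) * G) * ((G * K) * G))%D)
             (H := ((G * L) * (G * G * (K * G)))%D)
             (hom (fun x => (x.1.1, ((x.1.2, x.2.1.1), (x.2.1.2, x.2.2)))))
          (gmul (t G) (s G)))).

Definition Zone : Zfam 1%D :=
  fun G => gtr (G := (G * G)%D) (H := ((G * 1) * G)%D)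
               (hom (fun x => ((x.1, 1%g), x.2))) (pid G).

Definition ZA : green_data R D :=
  {| gd_car := Zfam; gd_mem := in_center;
     gd_add := fun _ t s G => t G + s G; gd_scale := fun _ r t G => r *: t G;
     gd_act := Zact; gd_mul := Zmul; gd_one := Zone |}.

Definition iotaA L : CA L -> ZA L := fun a G => rho a G.

Definition piA L : ZA L -> gdata A L :=
  fun t => gtr (G := ((1 * L) * 1)%D) (H := L) (hom (fun x => x.1.2)) (t 1%D).

End Green.

(* Main.v *)
(* The morphisms of RD composed here are, with one exception, classes of      *)
(* transitive bisets (H x G)/M, where the relation M is given by equations    *)
(* between coordinates. For such classes, products are products of relations  *)
(* and, when Mackey's formula has a single double coset, compositions are     *)
(* compositions of relations. The exception is an arbitrary u in RB(L,K),     *)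
(* which by linearity may be assumed to be transitive as well. Bifunctoriality*)
(* of the product of A writes both sides of each identity to be proved as     *)
(* A(w)(a x b) for some w in RD, and it remains to compare two relations. The *)
(* commutant and the center only serve to exchange a and b.                   *)

Require Import Defs.
From HB Require Import structures.
From mathcomp Require Import all_boot all_order all_algebra all_fingroup.
From mathcomp Require Import generic_quotient boolp.

Set Implicit Arguments.
Unset Strict Implicit.
Unset Printing Implicit Defensive.

(* [vector] shadows the notation [hom] of [Defs]. *)
Import GRing.Theory Defs.
Local Open Scope ring_scope.

(** A transitive class is determined by its stabilizer relation ([is_orbit_uniq]), so identities in
    [A] become comparisons of relations in coordinates. Composition in P_A forces the two inner
    coordinates to agree, and [rho a G] places the coordinate of [a] beside the diagonal of [G].

    Naturality of rho_a ([in_center_rho]): for b in A(HG), (b x L) o rho_(a,G) is b x a with its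
    coordinates reordered, and rho_(a,H) o b is a x b reordered to the same places; the commutant
    condition says exactly that these agree. Products are preserved because contracting two
    diagonals gives a diagonal ([iota_mul]). For the action of u in RB(L,K), [rb_class_span] reduces
    to u transitive, and composing its relation with diagonals leaves just that relation beside a
    diagonal ([iota_act]).

    The map pi evaluates at the trivial group, where diagonals and contracted coordinates vanish:
    composition of families becomes the external product ([pi_mul]), and u acts as in [A]
    ([pi_act]). Naturality of t at G = H = 1 says that t_1 commutes with A(1) ([pi_center]). Finally
    [rho a 1] is a up to trivial factors ([pi_iota]), which makes iota injective. *)

(** * Transitive bisets and their stabilizer relations *)

Section Stabilizer.
Implicit Types H G K : finGroupType.

(* [X] is isomorphic to (H x G)/M. *)
Definition biset_orbit H G (X : biset H G) (M : H -> G -> Prop) : Prop :=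
  exists x0 : X,
    (forall x, exists h g, x = bl X h (br X x0 g)) /\
    (forall h g, bl X h x0 = br X x0 g <-> M h g).

Lemma lact_inj H G (X : biset H G) h : injective (bl X h).
Proof. by apply: (can_inj (g := bl X h^-1%g)) => x; rewrite -lactM mulVg lact1. Qed.

Lemma biset_orbit_iso H G (X Y : biset H G) (M N : H -> G -> Prop) :
  biset_orbit X M -> biset_orbit Y N -> (forall h g, M h g <-> N h g) ->
  biset_iso X Y.
Proof.
move=> [x0 [Xx0 Mx0]] [y0 [Yy0 Ny0]] MN.
(* Equality of two points of an orbit is a condition on the stabilizer only, so h x0 g -> h y0 g is
   well defined and injective. *)
have XY h g h' g' : bl X h (br X x0 g) = bl X h' (br X x0 g') <->
                    bl Y h (br Y y0 g) = bl Y h' (br Y y0 g').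
  have red (Z : biset H G) (z : Z) : bl Z h (br Z z g) = bl Z h' (br Z z g') <->
      bl Z (h'^-1 * h)%g z = br Z z (g' * g^-1)%g.
    rewrite lactM ractM; split=> [e|].
      apply: (@lact_inj _ _ Z h'); rewrite -!lactM mulgV mul1g.
      have /(congr1 (fun t => br Z t g^-1%g)) := e.
      by rewrite -!lractA -!ractM mulgV ract1 => ->; rewrite ractM.
    move=> /(congr1 (fun t => br Z (bl Z h' t) g)).
    by rewrite -!lractA -!lactM -!ractM mulgA mulgV mul1g -mulgA mulVg mulg1 => ->.
  by rewrite !red; split=> [/Mx0/MN/Ny0|/Ny0/MN/Mx0].
have [h0 /choice[g0 e0]] := choice Xx0.
exists (fun x => bl Y (h0 x) (br Y y0 (g0 x))).
have fE h g : bl Y (h0 (bl X h (br X x0 g))) (br Y y0 (g0 (bl X h (br X x0 g)))) =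
              bl Y h (br Y y0 g).
  by apply/XY; rewrite -e0.
split.
- apply: inj_surj_bij => [x x' /XY|y]; first by rewrite -!e0.
  by have [h [g ->]] := Yy0 y; exists (bl X h (br X x0 g)).
- by move=> h x; rewrite {1 2}(e0 x) -lactM fE lactM.
- by move=> x g; rewrite {1 2}(e0 x) -lractA -ractM fE ractM lractA.
Qed.

Variable R : comPzRingType.

Definition is_orbit H G (w : RB R H G) (M : H -> G -> Prop) : Prop :=
  exists2 X : biset H G, w = [biset X] & biset_orbit X M.

Lemma is_orbit_uniq H G (v w : RB R H G) (M N : H -> G -> Prop) :
  is_orbit v M -> is_orbit w N -> (forall h g, M h g <-> N h g) -> v = w.
Proof.
move=> [X -> XM] [Y -> YN] MN.
exact/(rb_class_badditive R H G).1/(biset_orbit_iso XM YN).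
Qed.

Lemma is_orbit_equiv H G (w : RB R H G) (M N : H -> G -> Prop) :
  is_orbit w M -> (forall h g, M h g <-> N h g) -> is_orbit w N.
Proof.
move=> [X -> [x0 [Xx0 Mx0]]] MN; exists X => //; exists x0; split=> // h g.
by rewrite Mx0.
Qed.

Lemma is_orbit_push H G (f : {multiplicative G -> H}) :
  is_orbit ([biset push f] : RB R H G) (fun h g => h = f g).
Proof.
exists (push f) => //; exists (1%g : H); split=> [x | h g] /=.
  exists x, 1%g; rewrite mul1g.
  have f1 : f 1%g = 1%g by apply: (mulgI (f 1%g)); rewrite -gmulfM !mulg1.
  by rewrite f1 mulg1.
by rewrite mulg1 mul1g.
Qed.

Lemma is_orbit_pull H G (f : {multiplicative H -> G}) :
  is_orbit ([biset pull f] : RB R H G) (fun h g => g = f h).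
Proof.
exists (pull f) => //; exists (1%g : G); split=> [x | h g] /=.
  exists 1%g, x; rewrite mul1g.
  have f1 : f 1%g = 1%g by apply: (mulgI (f 1%g)); rewrite -gmulfM !mulg1.
  by rewrite f1 mul1g.
by rewrite mulg1 mul1g; split=> ->.
Qed.

Lemma is_orbit_id G : is_orbit (rb_id R G) (fun h g => h = g).
Proof. exact: is_orbit_push. Qed.

(* Mackey's formula when there is a single double coset. *)
Lemma is_orbit_comp H G K (v : RB R H G) (u : RB R G K) (M : H -> G -> Prop)
    (N : G -> K -> Prop) :
  is_orbit v M -> is_orbit u N ->
  (forall g, exists h g1 g2 k, [/\ M h g1, N g2 k & g = (g1 * g2)%g]) ->
  is_orbit (rb_comp v u) (fun h k => exists g, M h g /\ N g k).
Proof.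
move=> [V -> [v0 [Vv0 Mv0]]] [U -> [u0 [Uu0 Nu0]]] cov.
rewrite rb_comp_class; exists (tensor V U) => //.
have clE h x k : bl (tensor V U) h (br (tensor V U) (tclass (V := V) (U := U) x) k) =
    tclass (V := V) (U := U) (bl V h x.1, br U x.2 k).
  apply: val_inj => /=.
  rewrite !tmap_torbit //=; first by move=> w g; rewrite lractA.
  by move=> w g; rewrite lractA.
have clEq x y : tclass (V := V) (U := U) x = tclass y <->
    exists g, x = (br V y.1 g, bl U g^-1%g y.2).
  split=> [e | [g e]].
    have: x \in sval (tclass (V := V) (U := U) y) by rewrite -e torbit_refl.
    by move=> /imsetP[g _ ->]; exists g.
  apply: (@torbit_eq _ _ _ V U _ _ x); first exact: torbit_refl.
  by apply/imsetP; exists g.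
exists (tclass (v0, u0)); split=> [O | h k].
  have [[v' u'] eO] := tensor_class O.
  have {eO} -> : O = tclass (V := V) (U := U) (v', u') by apply: val_inj.
  have [h [g ->]] := Vv0 v'; have [g' [k ->]] := Uu0 u'.
  (* The class to reach is that of (h v0 g, g' u0 k). Factoring g g' = g1 g2, the stabilizers turn
     g1 into h1 on the left and g2 into k2 on the right. *)
  have [h1 [g1 [g2 [k2 [/Mv0 M1 /Nu0 N2 e]]]]] := cov (g * g')%g.
  exists (h * h1)%g, (k2 * k)%g; rewrite clE; apply/clEq => /=.
  exists (g1^-1 * g)%g; congr (_, _).
    by rewrite lactM M1 -!lractA -!ractM mulgA mulgV mul1g.
  rewrite ractM -N2 -lractA -!lactM; congr (bl U _ _).
  by rewrite invMg invgK -mulgA -e mulKg.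
have -> : bl (tensor V U) h (tclass (v0, u0)) = tclass (V := V) (U := U) (bl V h v0, u0).
  by rewrite -[X in bl _ h X](ract1 (bstr (tensor V U))) clE ract1.
have -> : br (tensor V U) (tclass (v0, u0)) k = tclass (V := V) (U := U) (v0, br U u0 k).
  by rewrite -[LHS](lact1 (bstr (tensor V U))) clE lact1.
rewrite clEq /=; split=> [[g [/Mv0 Mg e]] | [g [/Mv0 Mg /Nu0 Ng]]]; exists g.
  by split=> //; apply/Nu0; rewrite {1}e -lactM mulgV lact1.
by rewrite Mg -Ng -lactM mulVg lact1.
Qed.

Lemma is_orbit11 H G (w : RB R H G) (M : H -> G -> Prop) :
  is_orbit w M -> M 1%g 1%g.
Proof. by move=> [X _ [x0 [_ Mx0]]]; apply/Mx0; rewrite lact1 ract1. Qed.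

(** When [M] projects onto [G], the factorization g = g 1 meets the double coset condition;
    [is_orbit_compr] uses g = 1 g in the same way. *)
Lemma is_orbit_compl H G K (v : RB R H G) (u : RB R G K) (M : H -> G -> Prop)
    (N : G -> K -> Prop) :
  is_orbit v M -> is_orbit u N -> (forall g, exists h, M h g) ->
  is_orbit (rb_comp v u) (fun h k => exists g, M h g /\ N g k).
Proof.
move=> vM uN cov; apply: is_orbit_comp => // g; have [h Mhg] := cov g.
by exists h, g, 1%g, 1%g; rewrite mulg1; split=> //; apply: is_orbit11 uN.
Qed.

Lemma is_orbit_compr H G K (v : RB R H G) (u : RB R G K) (M : H -> G -> Prop)
    (N : G -> K -> Prop) :
  is_orbit v M -> is_orbit u N -> (forall g, exists k, N g k) ->
  is_orbit (rb_comp v u) (fun h k => exists g, M h g /\ N g k).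
Proof.
move=> vM uN cov; apply: is_orbit_comp => // g; have [k Ngk] := cov g.
by exists 1%g, 1%g, g, k; rewrite mul1g; split=> //; apply: is_orbit11 vM.
Qed.

Lemma is_orbit_push_comp H G K (f : {multiplicative G -> H}) (u : RB R G K)
    (N : G -> K -> Prop) :
  is_orbit u N ->
  is_orbit (rb_comp [biset push f] u) (fun h k => exists g, h = f g /\ N g k).
Proof.
move=> uN; apply: is_orbit_compl uN _; first exact: is_orbit_push.
by move=> g; exists (f g).
Qed.

Lemma is_orbit_prod H G H' G' (v : RB R H G) (u : RB R H' G')
    (M : H -> G -> Prop) (N : H' -> G' -> Prop) :
  is_orbit v M -> is_orbit u N ->
  is_orbit (rb_prod v u) (fun h g => M h.1 g.1 /\ N h.2 g.2).
Proof.
move=> [V -> [v0 [Vv0 Mv0]]] [U -> [u0 [Uu0 Nu0]]].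
rewrite rb_prod_class; exists (bprod V U) => //.
exists (v0, u0); split=> [[x y] | [h h'] [g g']] /=.
  have [h [g ->]] := Vv0 x; have [h' [g' ->]] := Uu0 y.
  by exists (h, h'), (g, g').
by rewrite -Mv0 -Nu0; split=> [[]|[-> ->]].
Qed.

Lemma is_orbit_set H G (u : RB R H G) (M : H -> G -> Prop) :
  is_orbit u M -> is_orbit (rb_set u) (fun a _ => M a.1 a.2).
Proof.
move=> [U -> [u0 [Uu0 Mu0]]]; rewrite rb_set_class; exists (bset U) => //.
exists u0; split=> [x | [h g] k] /=.
  have [h [g ->]] := Uu0 x.
  by exists (h, g^-1%g), 1%g; rewrite /= invgK.
rewrite lractA -Mu0; split=> [/(congr1 (fun x => br U x g))|->].
  by rewrite -ractM mulVg ract1.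
by rewrite -ractM mulgV ract1.
Qed.

(** * Reduction of linear identities to transitive classes *)

Section SubBiset.
Variables (H G : finGroupType) (X : biset H G) (P : pred X).
Hypothesis PM : forall h x g, P (bl X h (br X x g)) = P x.

Let Pl h (x : {x | P x}) : P (bl X h (val x)).
Proof. by rewrite -[val x](ract1 (bstr X)) PM (valP x). Qed.
Let Pr (x : {x | P x}) g : P (br X (val x) g).
Proof. by rewrite -[br _ _ _](lact1 (bstr X)) PM (valP x). Qed.

Definition sub_biset_on : biset_on H G {x | P x}.
Proof.
exists (fun h x => exist P _ (Pl h x)) (fun x g => exist P _ (Pr x g)).
- by move=> x; apply: val_inj; rewrite /= lact1.
- by move=> h k x; apply: val_inj; rewrite /= lactM.
- by move=> x; apply: val_inj; rewrite /= ract1.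
- by move=> x g k; apply: val_inj; rewrite /= ractM.
- by move=> h x g; apply: val_inj; rewrite /= lractA.
Defined.
Definition sub_biset : biset H G := Biset sub_biset_on.
End SubBiset.

Lemma biset_split H G (X : biset H G) (P : pred X)
    (PM : forall h x g, P (bl X h (br X x g)) = P x)
    (NM : forall h x g, ~~ P (bl X h (br X x g)) = ~~ P x) :
  biset_iso (bunion (sub_biset PM) (sub_biset NM)) X.
Proof.
exists (fun z => match z with inl x => val x | inr x => val x end).
split; [|by move=> h []|by move=> []].
apply: inj_surj_bij => [|x]; last first.
  by case: (boolP (P x)) => Px; [exists (inl (exist _ x Px)) | exists (inr (exist _ x Px))].
move=> [[x Px]|[x Px]] [[y Py]|[y Py]] /= e.
- by congr inl; apply: val_inj.
- by case/negP: Py; rewrite -e.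
- by case/negP: Px; rewrite e.
- by congr inr; apply: val_inj.
Qed.

Lemma linear_add (U V : lmodType R) (f : U -> V) :
  linear f -> {morph f : x y / x + y}.
Proof. by move=> fL x y; rewrite -[x]scale1r fL !scale1r. Qed.

Lemma linear_zero (U V : lmodType R) (f : U -> V) : linear f -> f 0 = 0.
Proof. by move=> fL; apply: (addrI (f 0)); rewrite -linear_add // !addr0. Qed.

Lemma linear_scale (U V : lmodType R) (f : U -> V) a :
  linear f -> {morph f : x / a *: x}.
Proof. by move=> fL x; rewrite -[a *: x]addr0 fL linear_zero // addr0. Qed.

Lemma linear_beval H G (M : lmodType R) (f : RB R H G -> M) l : linear f ->
  f (beval rb_class l) = beval (f \o rb_class) l.
Proof.
move=> fL; rewrite /beval; elim: l => [|x l IH]; first by rewrite !big_nil linear_zero.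
by rewrite !big_cons fL IH.
Qed.

(** Classes of bisets span, and a biset is the disjoint union of the orbit of a point and a smaller
    biset, so induction on cardinality leaves only transitive classes. *)
Lemma rb_class_span H G (M : lmodType R) (f g : RB R H G -> M) :
  linear f -> linear g ->
  (forall w N, is_orbit w N -> f w = g w) -> forall w, f w = g w.
Proof.
move=> fL gL fg w.
have -> : w = beval rb_class (repr w).
  apply/rb_eqP => N k kN; rewrite linear_beval; last exact: rb_lift_linear.
  by apply: eq_bigr => x _; rewrite /= rb_lift_class.
rewrite !linear_beval //; apply: eq_bigr => -[a U] _ /=; congr (_ *: _).
move: (sbiset_biset U) => {}U {a}.
have [n] := ubnP #|U|; elim: n U => // n IH U Un.
have clD := (rb_class_badditive R H G).2; have clI := (rb_class_badditive R H G).1.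
have [x0 _|U0] := pickP U; last first.
  (* An empty [U] satisfies U + U = U, so its class is zero. *)
  suff -> : [biset U] = 0 :> RB R H G by rewrite !linear_zero.
  apply: (addrI [biset U]); rewrite addr0 -clD; apply: clI.
  exists (fun z => match z with inl x => x | inr x => x end).
  split; [|by move=> h []|by move=> []].
  by apply: inj_surj_bij => [[x|x]|x]; have := U0 x.
pose P x := [exists h, exists g, x == bl U h (br U x0 g)].
have PP x : reflect (exists h g, x = bl U h (br U x0 g)) (P x).
  apply: (iffP existsP) => [[h /existsP[k /eqP e]]|[h [k e]]]; exists h.
    by exists k.
  by apply/existsP; exists k; apply/eqP.
have PM h x k : P (bl U h (br U x k)) = P x.
  apply/PP/PP => -[h' [k']].
    move=> /(congr1 (fun t => bl U h^-1%g (br U t k^-1%g))).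
    rewrite -!lractA -!lactM -!ractM mulVg mulgV lact1 ract1 lractA => ->.
    by exists (h^-1 * h')%g, (k' * k^-1)%g; rewrite lractA.
  by move=> ->; exists (h * h')%g, (k' * k)%g; rewrite -lractA -lactM -ractM.
have NM h x k : ~~ P (bl U h (br U x k)) = ~~ P x by rewrite PM.
rewrite -(clI _ _ (biset_split PM NM)) clD !linear_add //.
have Px0 : P x0 by apply/PP; exists 1%g, 1%g; rewrite lact1 ract1.
congr (_ + _); last first.
  apply: IH; rewrite -ltnS; apply: leq_trans Un; rewrite ltnS card_sig.
  by apply: proper_card; apply/properP; split; [apply/subsetP|exists x0; rewrite ?inE //= negbK].
apply: (fg _ (fun h k => bl U h x0 = br U x0 k)); exists (sub_biset PM) => //.
exists (exist _ x0 Px0); split=> [[x Px]|h k].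
  by have [h [k e]] := PP _ Px; exists h, k; apply: val_inj.
by split=> e; [apply: (congr1 val e) | apply: val_inj].
Qed.

End Stabilizer.

(** * Automatic comparison of relations in coordinates *)

Lemma ex_pair (S T : Type) (P : S * T -> Prop) :
  (exists x y, P (x, y)) -> exists z, P z.
Proof. by move=> [x [y Pxy]]; exists (x, y). Qed.

(* The relations compared are conjunctions of equations between coordinates:  *)
(* once the hypotheses are solved for variables, reflexivity instantiates the *)
(* existential witnesses.                                                     *)
Ltac split_vars :=
  repeat match goal with
  | x : ?T |- _ =>
    let T' := eval hnf in T in
    match T' with
    | prod _ _ => destruct x
    | unit => destruct x
    | ex _ => destruct x
    | and _ _ => destruct x
    | and3 _ _ _ => destruct x
    | @eq _ (_, _) (_, _) => injection x; clear x; intros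
    | @eq _ ?y _ => is_var y; subst y
    | @eq _ _ ?y => is_var y; subst y
    end
  end.

Ltac find_witness :=
  repeat match goal with
  | |- ex ?P =>
    match type of P with ?T -> _ =>
      let T' := eval hnf in T in
      match T' with
      | prod _ _ => apply: ex_pair
      | unit => exists tt
      | _ => eexists
      end end
  | |- and _ _ => split
  | |- and3 _ _ _ => split
  | |- _ => first [reflexivity | simpl; eassumption]
  end.

Ltac compare_orbits :=
  intros; cbv beta; try match goal with |- iff _ _ => split; intros end;
  do 2 (simpl in *; split_vars);
  find_witness.

(** * Stabilizer relations of the structural morphisms *)

Section Morphisms.
Variables (R : comPzRingType) (D : group_class).
Implicit Types G H K L : dgroup D.

(** The single morphism with b o a = A(wcomp)(b x a), see [pcompE]; [wmul] below does the same for
    the product of ZA, see [ZmulE]. *)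
Definition wcomp H G K : RB R (H * K)%D ((H * G) * (G * K))%D :=
  rb_comp (rb_comp (Iso R (hom (fun x => (x.1, x.2.2))
             : {multiplicative (H * (1 * K))%D -> (H * K)%D}))
                   (rb_prod (rb_id R H) (rb_prod (contract R G) (rb_id R K))))
    (Iso R (hom (fun x => (x.1.1, ((x.1.2, x.2.1), x.2.2)))
       : {multiplicative (H * G * (G * K))%D -> (H * (G * G * K))%D})).

Lemma contract_orbit G :
  is_orbit (contract R G) (fun _ x => x.1 = x.2).
Proof.
apply: is_orbit_equiv (is_orbit_push_comp _ (is_orbit_pull _ _)) _.
compare_orbits.
Qed.

Lemma wcomp_orbit H G K :
  is_orbit (wcomp H G K)
    (fun x y => [/\ x.1 = y.1.1, y.1.2 = y.2.1 & x.2 = y.2.2]).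
Proof.
apply: (is_orbit_equiv (is_orbit_compr (is_orbit_push_comp _
  (is_orbit_prod (is_orbit_id _ _)
     (is_orbit_prod (contract_orbit _) (is_orbit_id _ _)))) (is_orbit_push _ _) _)).
  by compare_orbits.
compare_orbits.
Qed.

Definition wshift L H G : RB R ((H * L) * (G * L))%D (H * G)%D :=
  rb_comp
    (Ind R (hom (fun x => ((x.1.1, x.2), (x.1.2, x.2)))
       : {multiplicative (H * G * L)%D -> ((H * L) * (G * L))%D}))
    (Inf R (hom (fun x => x.1) : {multiplicative (H * G * L)%D -> (H * G)%D})).

Lemma wshift_orbit L H G :
  is_orbit (wshift L H G)
    (fun x y => [/\ x.1.1 = y.1, x.2.1 = y.2 & x.1.2 = x.2.2]).
Proof.
apply: is_orbit_equiv (is_orbit_push_comp _ (is_orbit_pull _ _)) _.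
compare_orbits.
Qed.

Definition wrho2 L K G : RB R ((G * L) * (G * K))%D (L * K)%D :=
  rb_comp
    (Ind R (hom (fun x => ((x.1, x.2.1), (x.1, x.2.2)))
       : {multiplicative (G * (L * K))%D -> ((G * L) * (G * K))%D}))
    (Inf R (hom (fun x => x.2)
       : {multiplicative (G * (L * K))%D -> (L * K)%D})).

Lemma wrho2_orbit L K G :
  is_orbit (wrho2 L K G)
    (fun x y => [/\ x.1.2 = y.1, x.2.2 = y.2 & x.1.1 = x.2.1]).
Proof.
apply: is_orbit_equiv (is_orbit_push_comp _ (is_orbit_pull _ _)) _.
compare_orbits.
Qed.

Definition wrho L G : RB R ((G * L) * G)%D L :=
  rb_comp
    (Ind R (hom (fun x => ((x.2, x.1), x.2))
       : {multiplicative (L * G)%D -> ((G * L) * G)%D}))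
    (Inf R (hom (fun x => x.1) : {multiplicative (L * G)%D -> L})).

Lemma wrho_orbit L G :
  is_orbit (wrho L G) (fun x l => x.1.2 = l /\ x.1.1 = x.2).
Proof.
apply: is_orbit_equiv (is_orbit_push_comp _ (is_orbit_pull _ _)) _.
compare_orbits.
Qed.

Definition wpid G : RB R (G * G)%D 1%D :=
  rb_comp
      (Ind R (hom (fun x => (x, x)) : {multiplicative G -> (G * G)%D}))
      (Inf R (hom (fun=> 1%g) : {multiplicative G -> dunit D})).

Lemma wpid_orbit G : is_orbit (wpid G) (fun x _ => x.1 = x.2).
Proof.
apply: is_orbit_equiv (is_orbit_push_comp _ (is_orbit_pull _ _)) _.
compare_orbits.
Qed.

Definition wmul G L K : RB R ((G * (L * K)) * G)%D (((G * L) * G) * ((G * K) * G))%D :=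
  rb_comp (rb_comp (Iso R (hom (fun x => ((x.1.1, (x.1.2, x.2.2.1)), x.2.2.2))
      : {multiplicative ((G * L) * (1 * (K * G)))%D -> ((G * (L * K)) * G)%D}))
    (rb_prod (rb_id R (G * L)%D) (rb_prod (contract R G) (rb_id R (K * G)%D))))
    (Iso R (hom (fun x => (x.1.1, ((x.1.2, x.2.1.1), (x.2.1.2, x.2.2))))
      : {multiplicative (((G * L) * G) * ((G * K) * G))%D ->
                        ((G * L) * (G * G * (K * G)))%D})).

Lemma wmul_orbit G L K :
  is_orbit (wmul G L K)
    (fun x y => [/\ x.1.1 = y.1.1.1, x.1.2 = (y.1.1.2, y.2.1.2) &
                    x.2 = y.2.2 /\ y.1.2 = y.2.1.1]).
Proof.
apply: (is_orbit_equiv (is_orbit_compr (is_orbit_push_comp _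
  (is_orbit_prod (is_orbit_id _ _)
     (is_orbit_prod (contract_orbit _) (is_orbit_id _ _)))) (is_orbit_push _ _) _)).
  by compare_orbits.
compare_orbits.
Qed.

End Morphisms.

(** * Consequences of bifunctoriality of the product *)

Section GreenFunctor.
Variables (R : comPzRingType) (D : group_class) (A : green_functor R D).
Implicit Types G H K L : dgroup D.

Lemma pcompE H G K (b : A (H * G)%D) (a : A (G * K)%D) :
  pcomp b a = gact (wcomp R H G K) (gmul b a).
Proof. by rewrite /pcomp /gtr /gcontract -!gact_comp. Qed.

Lemma ZmulE L K (t : Zfam A L) (s : Zfam A K) G :
  Zmul t s G = gact (wmul R G L K) (gmul (t G) (s G)).
Proof. by rewrite /Zmul /gtr /gcontract -!gact_comp. Qed.

Lemma gact_lin G H (u : RB R H G) : linear (gact u : A G -> A H).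
Proof. exact: gact_linear. Qed.

Lemma gactD G H (u : RB R H G) (a b : A G) : gact u (a + b) = gact u a + gact u b.
Proof. exact: (linear_add (gact_linear u)). Qed.

Lemma gactZ G H (u : RB R H G) r (a : A G) : gact u (r *: a) = r *: gact u a.
Proof. exact: (linear_scale _ (gact_linear u)). Qed.

Lemma gact_linl G H (u v : RB R H G) r (a : A G) :
  gact (r *: u + v) a = r *: gact u a + gact v a.
Proof. exact: gact_linearl. Qed.

Lemma gmul_linl G H (a b : A G) r (c : A H) :
  gmul (r *: a + b) c = r *: gmul a c + gmul b c.
Proof. exact: gmul_linearl. Qed.

Lemma gact_eq G H (v w : RB R H G) (M N : H -> G -> Prop) (a : A G) :
  is_orbit v M -> is_orbit w N -> (forall h g, M h g <-> N h g) ->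
  gact v a = gact w a.
Proof. by move=> vM wN MN; rewrite (is_orbit_uniq vM wN MN). Qed.

Lemma gact_idP G (w : RB R G G) (M : G -> G -> Prop) (a : A G) :
  is_orbit w M -> (forall h g, M h g <-> h = g) -> gact w a = a.
Proof.
by move=> wM MN; rewrite -[RHS]gact_id; apply: gact_eq wM (is_orbit_id R G) MN.
Qed.

Lemma gmul_actl G H K (u : RB R H G) (a : A G) (b : A K) :
  gmul (gact u a) b =
  gact (G := (G * K)%D) (H := (H * K)%D) (rb_prod u (rb_id R K)) (gmul a b).
Proof. by rewrite gact_mul gact_id. Qed.

Lemma gmul_actr G H K (u : RB R H G) (a : A G) (b : A K) :
  gmul b (gact u a) =
  gact (G := (K * G)%D) (H := (K * H)%D) (rb_prod (rb_id R K) u) (gmul b a).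
Proof. by rewrite gact_mul gact_id. Qed.

Definition wunit L : RB R (1 * L)%D L :=
  Iso R (hom (fun x => (1%g, x)) : {multiplicative L -> (1 * L)%D}).

(** The unit axiom gives A(Iso)(gone x a) = a; [wunit] is the inverse isomorphism. *)
Lemma gmul_gone L (a : A L) : gmul (gone A) a = gact (wunit L) a.
Proof.
rewrite -{2}(gmul1l a) -gact_comp; symmetry; apply: gact_idP.
  apply: is_orbit_push_comp; exact: is_orbit_push.
compare_orbits.
Qed.

(** * The morphism iota *)

Lemma rhoE L (a : A L) G : rho a G = gact (wrho R L G) a.
Proof. by []. Qed.

(** Both sides become morphisms applied to b x a, the right one after exchanging the factors by
    [aC]; both relations identify ((h, l), g) with ((h, g), l). *)
Lemma in_center_rho L (a : A L) : in_commutant a -> in_center (fun G => rho a G).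
Proof.
move=> aC G H b; rewrite !pcompE !rhoE (_ : pshift L b = gact (wshift R L H G) b) //.
rewrite -gact_mul gmul_actl aC /gtr -!gact_comp.
apply: gact_eq.
- apply: is_orbit_comp (wcomp_orbit _ _ _ _)
    (is_orbit_prod (wshift_orbit _ _ _ _) (wrho_orbit _ _ _)) _.
  (* The first factor has equal inner pairs, as [wcomp] requires; the second absorbs the discrepancy
     while respecting the equations of [wshift] and [wrho]. The later explicit factorizations follow
     the same pattern. *)
  move=> [[[h l] [g l']] [[g' k] g2]].
  exists ((h, l), (g2 * g'^-1)%g).
  exists (((h, l), (1%g, l')), ((1%g, l'), (g2 * g'^-1)%g)).
  exists (((1%g, 1%g), (g, 1%g)), ((g', (l'^-1 * k)%g), g')).
  exists ((1%g, g), (l'^-1 * k)%g).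
  split=> //=; congr ((_, _, (_, _)), (_, _, _)); rewrite ?mulg1 ?mul1g ?mulKVg ?mulgKV //.
- apply: is_orbit_compr (is_orbit_comp (wcomp_orbit _ _ _ _)
    (is_orbit_prod (wrho_orbit _ _ _) (is_orbit_id _ _)) _) (is_orbit_push _ _) _.
    move=> [[[h l] h'] [h'' g]].
    exists ((h, l), g).
    exists (((h, l), h'), (h', g)).
    exists (((1%g, 1%g), 1%g), ((h'^-1 * h'')%g, 1%g)).
    exists (1%g, ((h'^-1 * h'')%g, 1%g)).
    by split=> //=; congr ((_, _, _), (_, _)); rewrite ?mulg1 ?mulKVg.
  compare_orbits.
compare_orbits.
Qed.

(** Since gone x a is [a] up to 1 x K = K, composing with an image of the identity element is the
    action of one morphism on [a]. *)
Lemma pcomp_upsilon L K H M (v : RB R (H * L)%D (dunit D)) (u : RB R (L * M)%D K) (a : A K) :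
  pcomp (gact v (gone A)) (gact u a) =
  gact (rb_comp (rb_comp (wcomp R H L M) (rb_prod v u)) (wunit K)) a.
Proof. by rewrite pcompE -gact_mul gmul_gone -!gact_comp. Qed.

Definition wups L K (u : RB R L K) G : RB R ((G * L) * (G * K))%D (dunit D) :=
  rb_comp (wrho2 R L K G) (rb_set u).

Lemma wups_orbit L K (u : RB R L K) (M : L -> K -> Prop) G :
  is_orbit u M ->
  is_orbit (wups u G) (fun x _ => x.1.1 = x.2.1 /\ M x.1.2 x.2.2).
Proof.
move=> uM.
apply: is_orbit_equiv (is_orbit_compl (wrho2_orbit _ _ _ _) (is_orbit_set uM) _) _.
  by move=> [l k]; exists ((1%g, l), (1%g, k)).
compare_orbits.
Qed.

Lemma ZactE L K (u : RB R L K) (t : Zfam A K) G :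
  Zact u t G = pcomp (gact (wups u G) (gone A)) (t G).
Proof. by rewrite /Zact /rho2 /upsilon -gact_comp. Qed.

Lemma wups_linear L K G : linear (fun u : RB R L K => wups u G).
Proof.
move=> r u v; rewrite /wups.
have -> : rb_set (r *: u + v) = r *: rb_set u + rb_set v by exact: rb_set_linear.
exact: rb_comp_linearr.
Qed.

(** Linearity in [u] is what allows [rb_class_span] to treat the action on ZA. *)
Lemma Zact_linear L K G (t : Zfam A K) :
  linear (fun u : RB R L K => Zact u t G).
Proof. by move=> r u v; rewrite !ZactE !pcompE wups_linear gact_linl gmul_linl gact_lin. Qed.

Lemma iota_act L K (u : RB R L K) (a : A K) G :
  rho (gact u a) G = Zact u (fun G => rho a G) G.
Proof.
move: u; apply: rb_class_span => [r u v|r u v|u M uM].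
- by rewrite !rhoE gact_linl gact_lin.
- by rewrite Zact_linear.
rewrite ZactE !rhoE pcomp_upsilon -gact_comp; apply: gact_eq.
- apply: is_orbit_compl (wrho_orbit _ _ _) uM _.
  by move=> l; exists ((1%g, l), 1%g).
- apply: is_orbit_compr (is_orbit_comp (wcomp_orbit _ _ _ _)
    (is_orbit_prod (wups_orbit _ uM) (wrho_orbit _ _ _)) _) (is_orbit_push _ _) _.
    move=> [[[x l] [y k]] [[z k'] w]].
    exists ((x, l), (w * (y^-1 * z)^-1)%g).
    exists (((x, l), (y, k)), ((y, k), (w * (y^-1 * z)^-1)%g)).
    exists (((1%g, 1%g), (1%g, 1%g)), (((y^-1 * z)%g, (k^-1 * k')%g), (y^-1 * z)%g)).
    exists (tt, (k^-1 * k')%g).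
    (* The relation of [u] contains (1, 1), being a stabilizer. *)
    split=> //=; first by do !split=> //; apply: is_orbit11 uM.
    by congr ((_, _, (_, _)), (_, _, _)); rewrite ?mulg1 ?mulKVg ?mulgKV.
  compare_orbits.
compare_orbits.
Qed.

Lemma iota_mul L K (a : A L) (b : A K) G :
  rho (gmul a b) G = Zmul (fun G => rho a G) (fun G => rho b G) G.
Proof.
rewrite ZmulE !rhoE -gact_mul -gact_comp; apply: gact_eq (wrho_orbit _ _ _) _ _.
  apply: is_orbit_comp (wmul_orbit _ _ _ _)
    (is_orbit_prod (wrho_orbit _ _ _) (wrho_orbit _ _ _)) _.
  move=> [[[x l] y] [[z k] w]].
  exists ((x, (l, k)), (w * (y^-1 * z)^-1)%g).
  exists (((x, l), y), ((y, k), (w * (y^-1 * z)^-1)%g)).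
  exists (((1%g, 1%g), 1%g), (((y^-1 * z)%g, 1%g), (y^-1 * z)%g)).
  exists (1%g, 1%g).
  split=> //=.
  by congr ((_, _, _), (_, _, _)); rewrite ?mulg1 ?mulKVg ?mulgKV.
compare_orbits.
Qed.

Lemma iota_one G : rho (gone A) G = Zone A G.
Proof.
rewrite /Zone /gtr /pid -gact_comp rhoE.
apply: gact_eq (wrho_orbit _ _ _) (is_orbit_push_comp _ (wpid_orbit _ _)) _.
compare_orbits.
Qed.

(** * The morphism pi, evaluation at the trivial group *)

Definition wpi L : RB R L ((1 * L) * 1)%D :=
  Iso R (hom (fun x => x.1.2) : {multiplicative ((1 * L) * 1)%D -> L}).

Lemma piAE L (t : Zfam A L) : piA t = gact (wpi L) (t 1%D).
Proof. by []. Qed.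

Lemma pi_act L K (u : RB R L K) (t : Zfam A K) :
  piA (Zact u t) = gact u (piA t).
Proof.
move: u; apply: rb_class_span => [r u v|r u v|u M uM].
- by rewrite !piAE Zact_linear gact_lin.
- by rewrite gact_linl.
(* The identity action is inserted so that [pcomp_upsilon] applies to [t 1]. *)
rewrite !piAE ZactE -[t 1%D in LHS]gact_id pcomp_upsilon -!gact_comp.
apply: gact_eq.
- apply: is_orbit_push_comp.
  apply: is_orbit_compr (is_orbit_comp (wcomp_orbit _ _ _ _)
    (is_orbit_prod (wups_orbit _ uM) (is_orbit_id _ _)) _) (is_orbit_push _ _) _.
    move=> [[[[] l] [[] k]] [[[] k'] []]].
    exists ((tt, l), tt).
    exists (((tt, l), (tt, k)), ((tt, k), tt)).
    exists (((tt, 1%g), (tt, 1%g)), ((tt, (k^-1 * k')%g), tt)).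
    exists (tt, ((tt, (k^-1 * k')%g), tt)).
    split=> //=; first by do !split=> //; apply: is_orbit11 uM.
    by congr ((_, _, (_, _)), (_, _, _)); rewrite ?mulg1 ?mulKVg.
  compare_orbits.
- apply: is_orbit_compr uM (is_orbit_push _ _) _.
  compare_orbits.
compare_orbits.
Qed.

(** At G = 1 the contracted coordinate is trivial, so [wmul] only rearranges coordinates and drops
    trivial ones. *)
Lemma pi_mul L K (t : Zfam A L) (s : Zfam A K) :
  piA (Zmul t s) = gmul (piA t) (piA s).
Proof.
rewrite !piAE ZmulE -gact_mul -gact_comp; apply: gact_eq.
- apply: is_orbit_push_comp (wmul_orbit _ _ _ _).
- apply: is_orbit_prod (is_orbit_push _ _) (is_orbit_push _ _).
compare_orbits.
Qed.

Lemma pi_one : piA (Zone A) = gone A.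
Proof.
rewrite piAE /Zone /gtr /pid -!gact_comp; apply: gact_idP.
  apply: is_orbit_compl (is_orbit_push_comp _ (is_orbit_push _ _)) (wpid_orbit _ _) _.
  compare_orbits.
compare_orbits.
Qed.

Lemma pi_iota L (a : A L) : piA (fun G => rho a G) = a.
Proof.
rewrite piAE rhoE -gact_comp; apply: gact_idP.
  exact: is_orbit_push_comp (wrho_orbit _ _ _).
compare_orbits.
Qed.

Definition wfst : RB R 1%D (1 * 1)%D :=
  Iso R (hom (fun x => x.1) : {multiplicative (1 * 1)%D -> dunit D}).

(** This is naturality of [t] at G = H = 1 against [b], viewed in A(1 x 1) through [wunit]. *)
Lemma pi_center (t : Zfam A 1%D) (b : A 1%D) : in_center t ->
  gact wfst (gmul (piA t) b) = gact wfst (gmul b (piA t)).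
Proof.
move=> /(_ 1%D 1%D (gact (wunit _) b)); rewrite !pcompE !piAE.
rewrite (_ : pshift _ _ = gact (wshift R 1 1 1) (gact (wunit _) b)) //.
rewrite gmul_actl [in RHS]gmul_actr gmul_actl gmul_actr -!gact_comp.
move=> /(congr1 (gact (wpi 1))); rewrite gmul_actl -!gact_comp => e.
(* [e] equates (b x 1) o t_1 with t_1 o b; it remains to identify t_1 o b with the product of pi(t)
   and b, and (b x 1) o t_1 with the product in the other order. *)
apply: etrans (etrans (esym e) _).
  apply: gact_eq.
  - apply: is_orbit_push_comp (is_orbit_prod (is_orbit_push _ _) (is_orbit_id _ _)).
  - apply: is_orbit_push_comp (is_orbit_compr (wcomp_orbit _ _ _ _)
      (is_orbit_prod (is_orbit_id _ _) (is_orbit_push _ _)) _).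
    compare_orbits.
  compare_orbits.
apply: gact_eq.
- apply: is_orbit_push_comp (is_orbit_compr (is_orbit_compr (wcomp_orbit _ _ _ _)
      (is_orbit_prod (wshift_orbit _ _ _ _) (is_orbit_id _ _)) _)
      (is_orbit_prod (is_orbit_push _ _) (is_orbit_id _ _)) _).
    compare_orbits.
  compare_orbits.
- apply: is_orbit_push_comp (is_orbit_prod (is_orbit_id _ _) (is_orbit_push _ _)).
compare_orbits.
Qed.

(** * Assembling the morphisms *)

Lemma iota_morphism : green_morphism (X := CA A) (Y := ZA A) (@iotaA R D A).
Proof.
split=> /= [L a aC|L a b _ _|L r a _|L K u a _|L K a b _ _|].
- exact: in_center_rho.
- by apply: functional_extensionality_dep => G; apply: gactD.
- by apply: functional_extensionality_dep => G; apply: gactZ.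
- by apply: functional_extensionality_dep => G; apply: iota_act.
- by apply: functional_extensionality_dep => G; apply: iota_mul.
- by apply: functional_extensionality_dep => G; apply: iota_one.
Qed.

Lemma pi_morphism : green_morphism (X := ZA A) (Y := gdata A) (@piA R D A).
Proof.
split=> //= [L t s _ _|L r t _|L K u t _|L K t s _ _|].
- exact: gactD.
- exact: gactZ.
- exact: pi_act.
- exact: pi_mul.
- exact: pi_one.
Qed.

Lemma pi_ring1_morphism :
  ring1_morphism_to_center (X := ZA A) (Y := gdata A) (@piA R D A 1%D).
Proof.
split=> [t tZ|t s|t s _ _|].
- by split=> // b _; apply: pi_center.
- exact: (gm_add pi_morphism).
- by rewrite /ring1_mul /= pi_act pi_mul.
- exact: pi_one.
Qed.

End GreenFunctor.

Theorem proposition39 (R : comPzRingType) (D : group_class)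
    (A : green_functor R D) :
  [/\ green_morphism (X := CA A) (Y := ZA A) (@iotaA R D A),
      green_morphism (X := ZA A) (Y := gdata A) (@piA R D A) /\
      ring1_morphism_to_center (X := ZA A) (Y := gdata A) (@piA R D A 1%D) &
      (forall (L : dgroup D) (a : CA A L), gd_mem a -> piA (iotaA a) = a) /\
      (forall (L : dgroup D) (a b : CA A L),
         gd_mem a -> gd_mem b -> iotaA a = iotaA b -> a = b)].
Proof.
split; first exact: iota_morphism.
  by split; [exact: pi_morphism | exact: pi_ring1_morphism].
split=> [L a _|L a b _ _ e]; first exact: pi_iota.
by rewrite -(pi_iota a) -(pi_iota b); congr piA.
Qed.
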